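(* Let $n\ge2$ and $v=(v_1,\dots,v_n)\in\mathsf H_+$. For all sufficiently small $\varepsilon>0$, $$\#\{u\in O_n^\times:\ \|\Lambda(u)-Tv\|_{\max}<\varepsilon\}\ \asymp_\varepsilon\ \exp\Big(\sum_{i=1}^{n-1}(n-i)v_iT\Big).$$ More precisely, $$2\Big(\frac{4\varepsilon}{(n-1)3^n}\Big)^{n-1}\le\liminf_{T\to\infty}\frac{\#\{u\in O_n^\times:\|\Lambda(u)-Tv\|_{\max}<\varepsilon\}}{\exp\big(\sum_{i=1}^{n-1}(n-i)v_iT\big)}\le\limsup_{T\to\infty}\frac{\#\{u\in O_n^\times:\|\Lambda(u)-Tv\|_{\max}<\varepsilon\}}{\exp\big(\sum_{i=1}^{n-1}(n-i)v_iT\big)}\le 2(4\varepsilon)^{n-1}n!.$$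
   Context: $\mathsf H_+=\{v=(v_1,\dots,v_n)\in\mathbb R^n:\ \sum_i v_i=0,\ v_1>\dots>v_n\}$; $\|\cdot\|_{\max}$ is the maximum norm on $\mathbb R^n$. Let $\mathcal K_n^\star$ be the set of totally real number fields $K$ of degree $n$. For each $K\in\mathcal K_n^\star$ let $\Sigma_K$ be the set of all ordered embeddings $\sigma=(\sigma_1,\dots,\sigma_n)$ of $K$ into $\mathbb R$ (that is, orderings of the $n$ embeddings $K\to\mathbb R$), and let $\mathcal K_n=\bigsqcup_{K\in\mathcal K_n^\star,\ \sigma\in\Sigma_K}(K,\sigma)$. Let $O_K^\times$ be the unit group of the ring of integers $O_K$ of $K$, and let $$O_n^\times=\bigsqcup_{(K,\sigma)\in\mathcal K_n}(O_K^\times,\sigma)$$ be the disjoint union. For $u\in(O_K^\times,\sigma)$ put $\Lambda(u)=(\log|\sigma_1(u)|,\dots,\log|\sigma_n(u)|)\in\mathbb R^n$. The notation $f(T)\asymp_\varepsilon g(T)$ means that there exist $C_1,C_2>0$, possibly depending on $\varepsilon$, such that $C_1g(T)\le f(T)\le C_2g(T)$ for all $T\ge1$.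
   Formalization: In ≍ the lower bound is claimed only for all sufficiently large T, since for T near 1 the count can be 0 (n=2, v=(1/10,-1/10), T=1, ε<1/10); the upper bound holds for all T≥1. Pairs (K,σ) are taken up to isomorphism of pairs. *)

(* Defs.v *)
From HB Require Import structures.
From mathcomp Require Import all_boot all_order all_algebra all_field.
From mathcomp Require Import all_classical all_reals all_analysis.
From mathcomp Require Import complex.

Set Implicit Arguments.
Unset Strict Implicit.
Unset Printing Implicit Defensive.

Import Order.TTheory GRing.Theory Num.Theory.
Import numFieldNormedType.Exports.

Local Open Scope classical_set_scope.
Local Open Scope ring_scope.

Definition Hplus (R : realType) (n : nat) : set 'rV[R]_n :=
  [set v | \sum_(i < n) v 0 i = 0 /\
           forall i j : 'I_n, (i < j)%N -> v 0 j < v 0 i].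

Definition totally_real (R : realType) (K : fieldExtType rat) : Prop :=
  forall (f : {rmorphism K -> complex R}) (x : K), complex.Im (f x) = 0.

Record ordered_embeddings (R : realType) (n : nat) (K : fieldExtType rat) := {
  emb : 'I_n -> {rmorphism K -> R};
  emb_inj : forall i j : 'I_n, emb i =1 emb j -> i = j;
  emb_surj : forall f : {rmorphism K -> R}, exists i : 'I_n, emb i =1 f }.

Record ordered_field (R : realType) (n : nat) := {
  nf :> fieldExtType rat;
  nf_degree : \dim {: nf} = n;
  nf_totally_real : totally_real R nf;
  nf_emb : ordered_embeddings R n nf }.

Definition minkowski (R : realType) (n : nat) (K : ordered_field R n) (x : K) :
    'rV[R]_n :=
  \row_(i < n) emb (nf_emb K) i x.

(* Number fields, hence pairs (K, sigma), are taken up to isomorphism: an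
   isomorphism K -> K' must carry the ordered embeddings of K to those of K'. *)
Definition ordered_iso (R : realType) (n : nat) (K K' : ordered_field R n) :
    Prop :=
  exists2 f : {rmorphism K -> K'}, bijective f &
    forall (i : 'I_n) (x : K), emb (nf_emb K') i (f x) = emb (nf_emb K) i x.

Lemma minkowski_inj (R : realType) (n : nat) (K : ordered_field R n) :
  injective (@minkowski R n K).
Proof.
have n_gt0 : (0 < n)%N by rewrite -(nf_degree K) adim_gt0.
move=> x y /rowP /(_ (Ordinal n_gt0)); rewrite !mxE; exact: fmorph_inj.
Qed.

(* The image of the Minkowski embedding is a complete invariant of the
   isomorphism class of (K, sigma), and so serves as a name for that class. *)
Lemma range_minkowskiP (R : realType) (n : nat) (K K' : ordered_field R n) :
  range (@minkowski R n K) = range (@minkowski R n K') <-> ordered_iso K K'.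
Proof.
split=> [KK'|[f [g fK gK] fE]]; last first.
  apply/seteqP; split=> _ [x _ <-].
    by exists (f x) => //; apply/rowP => i; rewrite !mxE fE.
  by exists (g x) => //; apply/rowP => i; rewrite !mxE -fE gK.
have ex (L L' : ordered_field R n) :
    range (@minkowski R n L) = range (@minkowski R n L') ->
    exists h : L -> L', forall x, minkowski (h x) = minkowski x.
  move=> LL'.
  have {}LL' (x : L) : exists y : L', minkowski y = minkowski x.
    have : range (@minkowski R n L') (minkowski x) by rewrite -LL'; exists x.
    by case=> y _ <-; exists y.
  by have [h hP] := boolp.choice LL'; exists h.
have [h hE] := ex _ _ KK'; have [g gE] := ex _ _ (esym KK').
have hi i x : emb (nf_emb K') i (h x) = emb (nf_emb K) i x.
  by have /rowP/(_ i) := hE x; rewrite !mxE.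
have hB : zmod_morphism h.
  move=> x y; apply: minkowski_inj; apply/rowP => i.
  by rewrite !mxE !(hi, rmorphB).
have hM : monoid_morphism h.
  split=> [|x y]; apply: minkowski_inj; apply/rowP => i.
    by rewrite !mxE !(hi, rmorph1).
  by rewrite !mxE !(hi, rmorphM).
pose bA := GRing.isZmodMorphism.Build _ _ h hB.
pose bM := GRing.isMonoidMorphism.Build _ _ h hM.
pose f : {rmorphism K -> K'} := HB.pack h bA bM.
exists f; last exact: hi.
exists g => x; apply: minkowski_inj.
  by rewrite gE hE.
by rewrite hE gE.
Qed.

Definition ring_of_integers (K : fieldExtType rat) : set K :=
  [set x | integralOver (intr : int -> K) x].

Definition integer_units (K : fieldExtType rat) : set K :=
  [set x | [/\ x != 0, ring_of_integers x & ring_of_integers x^-1]].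

(* The disjoint union over classes of (K, sigma): the first component is the
   index, the second is (sigma_1(u), ..., sigma_n(u)), which determines the
   unit u of O_K by [minkowski_inj]. *)
Definition On_units (R : realType) (n : nat) :
    set (set 'rV[R]_n * 'rV[R]_n)%type :=
  [set p | exists K : ordered_field R n,
     p.1 = range (@minkowski R n K) /\
     exists2 u : K, integer_units u & p.2 = minkowski u].

Definition Lambda (R : realType) (n : nat) (w : 'rV[R]_n) : 'rV[R]_n :=
  map_mx (fun a : R => ln `|a|) w.

(* [mx_norm] is the maximum norm of the entries. The value is +oo when the set
   counted is infinite. *)
Definition unit_count (R : realType) (n : nat) (v : 'rV[R]_n) (e T : R) :
    \bar R :=
  counting [set p | On_units p /\ mx_norm (Lambda p.2 - T *: v) < e].

Definition growth (R : realType) (n : nat) (v : 'rV[R]_n) (T : R) : R :=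
  expR (\sum_(i < n | (i.+1 < n)%N) (n - i.+1)%:R * v 0 i * T).

(* The lower bound is required only for large T: a count can vanish for T near
   1, as [unit_count v e 1] does for n = 2, v = (1/10, -1/10), e < 1/10. *)
Definition asymp (R : realType) (f : R -> \bar R) (g : R -> R) : Prop :=
  exists C1 C2 : R, [/\ 0 < C1, 0 < C2,
    forall T : R, 1 <= T -> (f T <= (C2 * g T)%:E)%E &
    \forall T \near +oo, ((C1 * g T)%:E <= f T)%E].

(* Main.v *)
Require Import Defs.
From HB Require Import structures.
From mathcomp Require Import all_boot all_order all_fingroup all_algebra all_field.
From mathcomp Require Import cyclic finmap.
From mathcomp Require Import all_classical all_reals all_analysis.
From mathcomp Require Import complex.
From mathcomp Require Import zify lra ring.
From mathcomp Require polyrcf.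

Set Implicit Arguments.
Unset Strict Implicit.
Unset Printing Implicit Defensive.

Import Order.TTheory GRing.Theory Num.Theory.
Import numFieldNormedType.Exports.

Local Open Scope classical_set_scope.
Local Open Scope ring_scope.

(** Entries of v are numbered from 1 in this comment and from 0 below. Write
    V_k = v_1 + ... + v_k. As v is strictly decreasing with sum zero,
    V_k > 0 for 0 < k < n, and the growth function is the product of the
    exp (T V_k) over these k.

    A unit u with Lambda(u) close to T v has conjugates w_1, ..., w_n of
    pairwise distinct absolute values. Hence u generates its field, and the
    field, its ordered embeddings and u are all determined by the integer
    polynomial P = (X - w_1) ... (X - w_n), whose constant term is 1 or -1
    ([On_units_int_poly], [near_units_inj]). The theorem is therefore a count of
    such polynomials.

    Upper bound. Up to sign the coefficient of X^(n-k) in P is the elementary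
    symmetric function e_k(w). The product w_1 ... w_k dominates it: every
    other product of k conjugates is smaller by a factor exp (- T d) up to a
    constant, where d is a lower bound for the gaps of v ([coef_near]). So the
    absolute value of this coefficient lies in a window of length about
    (e^(k eps) - e^(- k eps)) exp (T V_k). Counting the integers in the n - 1
    windows, with the n signs, gives [unit_count_le]. For small eps one has
    e^(k eps) - e^(- k eps) < 2 (k + 1) eps, and the product over k of the
    factors k + 1 is n!.

    Lower bound. Let P be a monic integer polynomial with constant term 1 or
    -1 whose coefficient of X^(n-k) has absolute value between
    exp (T V_k - delta) and exp (T V_k + delta), where delta = eps / 3. At a
    point x with |x| = exp (T v_k + e') the term of index k - 1 of P dominates
    all the others, and at |x| = exp (T v_k - e') the term of index k does, so
    for one choice of the sign of x the polynomial changes sign in between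
    ([exists_root_near]). This produces n real roots near the prescribed sizes.
    If P is moreover irreducible, then Q[X]/(P) is a totally real field, the
    roots order its embeddings, and the class of X is a unit that is counted
    ([On_units_of_poly]). Irreducibility is enforced by prescribing P modulo 2
    to be a fixed irreducible polynomial over F_2. This divides the number of
    polynomials by 2^(n-1), a loss that the constant of the lower bound
    absorbs ([unit_count_ge]). *)

Local Notation pZtoQ := (map_poly (intr : int -> rat)).

(** * Irreducible polynomials *)

(** The minimal polynomial over F_p of a generator of the multiplicative group
    of the field with p^n elements has degree n, since such a generator also
    generates the field. *)
Lemma exists_irreducible_Fp (p n : nat) : prime p -> (0 < n)%N ->
  exists q : {poly 'F_p}, [/\ q \is monic, size q = n.+1 & irreducible_poly q].
Proof.
move=> p_pr n_gt0; have [F charF cardF] := pPrimePowerField p_pr n_gt0.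
pose L : fieldExtType 'F_p := pPrimeCharType charF.
have dimL : \dim {:L} = n.
  by rewrite pprimeChar_dimf [#|_|]cardF pfactorK.
have /cyclicP[g gE] := field_unit_group_cyclic (setT_group {unit F}).
pose z : L := val g.
have genz : <<1; z>>%VS = {:L}%VS.
  apply/eqP; rewrite eqEsubv subvf /=; apply/subvP => x _.
  have [->|x0] := eqVneq x 0; first exact: mem0v.
  have /cycleP[i xE] : finField_unit x0 \in <[g]>%g by rewrite -gE inE.
  have -> : x = z ^+ i.
    by have /(congr1 val) := xE; rewrite FinRing.val_unitX.
  by rewrite rpredX // memv_adjoin.
have szm : size (minPoly 1 z) = n.+1.
  by rewrite size_minPoly adjoin_degreeE genz dimL dimv1 divn1.
have /polyOver1P[q qE] := minPolyOver 1 z.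
exists q; split.
- by have := monic_minPoly 1 z; rewrite qE map_monic.
- by rewrite -szm qE size_map_poly.
split; first by rewrite -(size_map_poly (in_alg L)) -qE szm.
move=> r r1; rewrite -(dvdp_map (in_alg L)) -qE => rq.
rewrite -(eqp_map (in_alg L)) -qE.
have /orP[//|] := minPoly_irr (alg_polyOver _ r) rq.
by rewrite -size_poly_eq1 size_map_poly (negPf r1).
Qed.

(** By Gauss's lemma a rational factor of P can be taken integral, with leading
    coefficient a unit because P is monic. Reduction then preserves the degrees
    of the factor and of P. *)
Lemma irreducible_of_reduction (F : fieldType) (f : {rmorphism int -> F})
    (P : {poly int}) :
  P \is monic -> irreducible_poly (map_poly f P) -> irreducible_poly (pZtoQ P).
Proof.
move=> Pmon [szP irrP].
have szE (Q : {poly int}) : lead_coef Q \is a GRing.unit ->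
    size (map_poly f Q) = size Q.
  move=> lQ; apply: size_poly_eq.
  have : f (lead_coef Q) \is a GRing.unit by apply: rmorph_unit.
  by rewrite unitfE.
split; first by rewrite size_rat_int_poly -(szE P) // (monicP Pmon) unitr1.
move=> q + /dvdpP_rat_int[r [c c0 qE] [s sE]].
rewrite qE size_scale // size_rat_int_poly => r1.
have lrs : lead_coef r * lead_coef s = 1.
  by rewrite -lead_coefM -sE (monicP Pmon).
have lr : lead_coef r \is a GRing.unit.
  by apply/unitrPr; exists (lead_coef s).
have rE : map_poly f r %= map_poly f P.
  apply: irrP; first by rewrite szE.
  by rewrite sE rmorphM /= dvdp_mulIl.
have szr : size r = size P.
  by rewrite -(szE r) // (eqp_size rE) szE // (monicP Pmon) unitr1.
rewrite -dvdp_size_eqp; last first.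
  by rewrite dvdpZl // dvdp_rat_int sE dvdp_mulIl.
by rewrite size_scale // !size_rat_int_poly szr.
Qed.
(** * Units and their integer polynomials *)

Lemma rmorph_horner_alg (K : fieldExtType rat) (S : numFieldType)
    (f : {rmorphism K -> S}) (q : {poly rat}) (x : K) :
  f (map_poly (in_alg K) q).[x] = (map_poly ratr q).[f x].
Proof.
rewrite -horner_map -map_poly_comp; congr horner; apply: eq_map_poly => a.
exact: (fmorph_eq_rat (f \o in_alg K)).
Qed.

Lemma root_irreducible_dvdp (F : fieldType) (K : fieldExtType F)
    (p q : {poly F}) (z : K) : irreducible_poly p ->
  root (map_poly (in_alg K) p) z -> root (map_poly (in_alg K) q) z -> p %| q.
Proof.
move=> [p1 irrp] pz qz.
suff : gcdp p q %= p by move=> /eqp_dvdl <-; exact: dvdp_gcdr.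
apply: irrp; last exact: dvdp_gcdl.
apply/negP => /size_poly1P[c c0 gE].
have : root (map_poly (in_alg K) (gcdp p q)) z by rewrite gcdp_map root_gcd pz.
by rewrite gE map_polyC rootC fmorph_eq0 (negPf c0).
Qed.

(** Sending q(z) to q(a) is well defined, because a rational polynomial that
    vanishes at z is divisible by p and so vanishes at a. *)
Lemma exists_rmorphism_root (K : fieldExtType rat) (z : K) (S : numFieldType)
    (p : {poly rat}) (a : S) :
  irreducible_poly p -> root (map_poly (in_alg K) p) z ->
  <<1; z>>%VS = fullv -> root (map_poly ratr p) a ->
  exists f : {rmorphism K -> S}, f z = a.
Proof.
move=> irrp pz genz pa.
have vanish q : (map_poly (in_alg K) q).[z] = 0 -> (map_poly ratr q).[a] = 0.
  move=> /eqP/(root_irreducible_dvdp irrp pz)/dvdpP[s ->].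
  by rewrite rmorphM hornerM (rootP pa) mulr0.
have welldef q r : (map_poly (in_alg K) q).[z] = (map_poly (in_alg K) r).[z] ->
    (map_poly ratr q).[a] = (map_poly ratr r).[a] :> S.
  move=> qr; apply/eqP; rewrite -subr_eq0 -hornerN -hornerD -rmorphB /= vanish //.
  by rewrite rmorphB /= hornerD hornerN qr subrr.
have /boolp.choice[q qE] (y : K) : exists q, y = (map_poly (in_alg K) q).[z].
  by apply/Fadjoin1_polyP; rewrite genz memvf.
pose h y : S := (map_poly ratr (q y)).[a].
have hE r : h (map_poly (in_alg K) r).[z] = (map_poly ratr r).[a].
  by apply: welldef; rewrite -qE.
have hB : zmod_morphism h.
  move=> x y; rewrite {1}[x]qE {1}[y]qE -hornerN -hornerD -rmorphB hE.
  by rewrite rmorphB hornerD hornerN.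
have hM : monoid_morphism h.
  split=> [|x y].
    rewrite -[1](hornerC _ z) -[1%:P](rmorph1 (map_poly (in_alg K))) hE.
    by rewrite rmorph1 hornerC.
  by rewrite {1}[x]qE {1}[y]qE -hornerM -rmorphM hE rmorphM hornerM.
pose bA := GRing.isZmodMorphism.Build _ _ h hB.
pose bM := GRing.isMonoidMorphism.Build _ _ h hM.
pose f : {rmorphism K -> S} := HB.pack h bA bM.
exists f => /=.
by rewrite -[z in LHS]hornerX -(map_polyX (in_alg K)) hE map_polyX hornerX.
Qed.

(** The minimal polynomial of u over Q is integral by Gauss's lemma. It has the n
    distinct conjugates of u as roots, so its degree is n: u generates the
    field, and the conjugates exhaust the roots. *)
Lemma integral_primitive_poly (R : realType) (n : nat) (K : ordered_field R n)
    (u : K) : ring_of_integers u ->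
  injective (fun i => emb (nf_emb K) i u) ->
  <<1; u>>%VS = fullv /\
  exists P : {poly int},
    \prod_(i < n) ('X - (Defs.minkowski u 0 i)%:P) = map_poly intr P.
Proof.
move=> [p0 p0mon p0u] uinj.
have /polyOver1P[q qE] := minPolyOver 1 u.
have qmon : q \is monic.
  by have := monic_minPoly 1 u; rewrite qE map_monic.
have p0E : map_poly intr p0 = map_poly (in_alg K) (pZtoQ p0).
  rewrite -map_poly_comp; apply: eq_map_poly => a.
  by rewrite -[RHS]/(in_alg K a%:~R) rmorph_int.
have qp0 : q %| pZtoQ p0.
  rewrite -(dvdp_map (in_alg K)) -qE -p0E; apply: minPoly_dvdp => //.
  by rewrite p0E alg_polyOver.
have [p1 [a a0 qp1] [r p0r]] := dvdpP_rat_int qp0.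
have lr : lead_coef p1 * lead_coef r = 1.
  by rewrite -lead_coefM -p0r (monicP p0mon).
have lr' : lead_coef p1 \is a GRing.unit.
  by apply/unitrPr; exists (lead_coef r).
have aE : a * (lead_coef p1)%:~R = 1.
  have := monicP qmon; rewrite qp1 lead_coefZ lead_coef_map_inj //.
  exact: intr_inj.
have aE' : a = (lead_coef p1)%:~R.
  move: lr' aE => /pred2P[->|->]; rewrite ?rmorphN1 ?mulr1 ?mulrN1 // => <-.
  by rewrite opprK.
have {}qE' : q = pZtoQ (lead_coef p1 *: p1).
  by rewrite linearZ /= -aE'.
pose rs := [seq emb (nf_emb K) i u | i <- enum 'I_n].
have rsu : uniq rs by rewrite map_inj_uniq // enum_uniq.
have szrs : size rs = n by rewrite size_map size_enum_ord.
pose Q := map_poly (ratr : rat -> R) q.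
have Qmon : Q \is monic by rewrite map_monic.
have Qrs : all (root Q) rs.
  apply/allP => _ /mapP[i _ ->]; apply/rootP.
  by rewrite -rmorph_horner_alg -qE minPolyxx rmorph0.
have szQ : size Q = (\dim <<1; u>>%VS).+1.
  by rewrite size_map_poly -(size_map_poly (in_alg K)) -qE size_minPoly adjoin_degreeE
    dimv1 divn1.
have ltQ : (n < size Q)%N.
  by rewrite -szrs; apply: max_poly_roots => //; exact: monic_neq0.
have dimE : \dim <<1; u>>%VS = n.
  apply/eqP; rewrite eqn_leq; move: ltQ; rewrite szQ ltnS => ->.
  by rewrite andbT; apply: leq_trans (dimvS (subvf _)) _; rewrite nf_degree.
split.
  by apply/eqP; rewrite eqEdim subvf /= nf_degree dimE.
exists (lead_coef p1 *: p1).
have : Q = lead_coef Q *: \prod_(z <- rs) ('X - z%:P).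
  apply: all_roots_prod_XsubC => //; first by rewrite szQ dimE szrs.
  by rewrite uniq_rootsE.
rewrite (monicP Qmon) scale1r big_map big_enum /= => QE.
under eq_bigr do rewrite mxE.
rewrite -QE /Q qE' -map_poly_comp; apply: eq_map_poly => b /=.
by rewrite ratr_int.
Qed.
Lemma coef0_prod_XsubC (R : comNzRingType) (n : nat) (F : 'I_n -> R) :
  (\prod_(i < n) ('X - (F i)%:P))`_0 = (-1) ^+ n * \prod_(i < n) F i.
Proof.
rewrite -horner_coef0 horner_prod.
under eq_bigr do rewrite hornerXsubC sub0r.
by rewrite prodrN card_ord.
Qed.

(** The constant term is a unit of Z because its product with the constant term
    of the polynomial attached to the inverse unit is 1. *)
Lemma On_units_int_poly (R : realType) (n : nat)
    (p : set 'rV[R]_n * 'rV[R]_n) :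
  On_units p -> injective (p.2 0) ->
  exists P : {poly int},
    [/\ \prod_(i < n) ('X - (p.2 0 i)%:P) = map_poly intr P,
        `|P`_0| = 1 & forall i, p.2 0 i != 0].
Proof.
move=> [K [_ [u [u0 uint uVint] ->]]] winj.
have uinj : injective (fun i => emb (nf_emb K) i u).
  by move=> i j ij; apply: winj; rewrite !mxE.
have uVinj : injective (fun i => emb (nf_emb K) i u^-1).
  by move=> i j /=; rewrite !fmorphV => /invr_inj/uinj.
have [_ [P PE]] := integral_primitive_poly uint uinj.
have [_ [Q QE]] := integral_primitive_poly uVint uVinj.
exists P; split=> //; last by move=> i; rewrite mxE fmorph_eq0.
have PQ : (P`_0 * Q`_0)%:~R = 1 :> R.
  rewrite rmorphM /= -!coef_map -PE -QE !coef0_prod_XsubC.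
  rewrite mulrACA -expr2 sqrr_sign mul1r -big_split big1 //= => i _.
  by rewrite !mxE fmorphV mulfV // fmorph_eq0.
have {}PQ : P`_0 * Q`_0 = 1 by apply: (@intr_inj R); rewrite PQ.
have : P`_0 \is a GRing.unit by apply/unitrPr; exists Q`_0.
by move=> /pred2P[->|->].
Qed.

(** A unit with distinct conjugates generates its field, so the Minkowski image
    of the field consists of the vectors (q(w_1), ..., q(w_n)) for rational
    polynomials q, which depend on w only. *)
Lemma On_units_snd_inj (R : realType) (n : nat)
    (p q : set 'rV[R]_n * 'rV[R]_n) :
  On_units p -> On_units q -> injective (p.2 0) -> p.2 = q.2 -> p = q.
Proof.
have sub (K L : ordered_field R n) (u : K) (w : L) : ring_of_integers u ->
    injective (Defs.minkowski u 0) -> Defs.minkowski u = Defs.minkowski w ->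
    range (@Defs.minkowski R n K) `<=` range (@Defs.minkowski R n L).
  move=> uint uinj uw _ [x _ <-].
  have [|genu _] := integral_primitive_poly uint.
    by move=> i j ij; apply: uinj; rewrite !mxE.
  have /Fadjoin1_polyP[r ->] : x \in <<1; u>>%VS by rewrite genu memvf.
  exists (map_poly (in_alg L) r).[w] => //; apply/rowP => i.
  rewrite !mxE !rmorph_horner_alg; congr (_.[_]).
  by have /rowP/(_ i) := uw; rewrite !mxE.
case: p q => [p1 p2] [q1 q2] [K [/= -> [u [_ uint _] ->]]].
move=> [L [/= -> [w [_ wint _] ->]]] uinj uw; congr pair => //.
apply/seteqP; split; first exact: sub uw.
by apply: (sub L K w u) => //; rewrite -uw.
Qed.

(** The field is Q[X]/(P) and the unit is the class z of X. Every morphism to an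
    extension S of R sends z to a root of P in S, that is, to one of the x_i.
    For S = R this shows that there are no further embeddings. For S the
    complex numbers it shows that the field is totally real. *)
Lemma On_units_of_poly (R : realType) (n : nat) (P : {poly int})
    (x : 'rV[R]_n) :
  P \is monic -> irreducible_poly (pZtoQ P) -> `|P`_0| = 1 ->
  \prod_(i < n) ('X - (x 0 i)%:P) = map_poly intr P -> injective (x 0) ->
  exists A, On_units (A, x).
Proof.
move=> Pmon irrP P0 PE xinj.
have [K dimK [z rootz genz]] := irredp_FAdjoin irrP.
have PratE (S : numFieldType) :
    map_poly ratr (pZtoQ P) = map_poly intr P :> {poly S}.
  by rewrite -map_poly_comp; apply: eq_map_poly => a /=; rewrite ratr_int.
have szP : (size P).-1 = n.
  rewrite -(size_map_inj_poly (@intr_inj R)) // -PE size_prod_XsubC.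
  by rewrite /index_enum -enumT size_enum_ord.
have dimKn : \dim {:K} = n by rewrite dimK size_rat_int_poly.
have rootxP (S : numFieldType) (f : {rmorphism R -> S}) (a : S) :
    root (map_poly ratr (pZtoQ P)) a <-> exists i, a = f (x 0 i).
  have -> : map_poly ratr (pZtoQ P) = \prod_(i < n) ('X - (f (x 0 i))%:P).
    transitivity (map_poly f (map_poly intr P)).
      by rewrite PratE -map_poly_comp; apply: eq_map_poly => b /=; rewrite rmorph_int.
    rewrite -PE rmorph_prod; apply: eq_bigr => i _.
    by rewrite rmorphB /= map_polyX map_polyC.
  rewrite rootE horner_prod; split.
    by move=> /prodf_eq0[i _]; rewrite hornerXsubC subr_eq0 => /eqP ->; exists i.
  by case=> i ->; apply/prodf_eq0; exists i => //; rewrite hornerXsubC subrr.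
have rootz' (S : numFieldType) (f : {rmorphism K -> S}) :
    root (map_poly ratr (pZtoQ P)) (f z).
  by apply/rootP; rewrite -rmorph_horner_alg (rootP rootz) rmorph0.
have gen (y : K) : exists q, y = (map_poly (in_alg K) q).[z].
  by apply/Fadjoin1_polyP; rewrite genz memvf.
have /boolp.choice[e eE] (i : 'I_n) : exists f : {rmorphism K -> R}, f z = x 0 i.
  apply: (exists_rmorphism_root irrP rootz genz).
  by apply/(rootxP R idfun); exists i.
have totr : totally_real R K.
  move=> f y; have [q ->] := gen y.
  have [i fz] := (rootxP _ (real_complex R) _).1 (rootz' _ f).
  rewrite rmorph_horner_alg fz.
  have -> : map_poly ratr q = map_poly (real_complex R) (map_poly ratr q).
    rewrite -map_poly_comp; apply: eq_map_poly => b.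
    by rewrite [RHS]fmorph_eq_rat.
  by rewrite horner_map.
have einj (i j : 'I_n) : e i =1 e j -> i = j.
  by move=> /(_ z); rewrite !eE => /xinj.
have esurj (f : {rmorphism K -> R}) : exists i : 'I_n, e i =1 f.
  have [i fz] := (rootxP R idfun _).1 (rootz' _ f); exists i => y.
  by have [q ->] := gen y; rewrite !rmorph_horner_alg eE fz.
pose Ks := Build_ordered_field dimKn totr (Build_ordered_embeddings einj esurj).
exists (range (@Defs.minkowski R n Ks)); exists Ks; split => //.
exists z; last by apply/rowP => i; rewrite !mxE /= eE.
have intP (Q : {poly int}) : map_poly (in_alg K) (pZtoQ Q) = map_poly intr Q.
  rewrite -map_poly_comp; apply: eq_map_poly => a /=.
  by rewrite -[LHS]/(in_alg K a%:~R) rmorph_int.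
have zint : ring_of_integers z.
  by exists P => //; rewrite -intP.
(* With P = P(0) + X D the inverse of z is - P(0) D(z), as P(0)^2 = 1. *)
have [zinv_poly zE] : exists Q : {poly int}, z * (map_poly intr Q).[z] = 1.
  pose Q := - P`_0 *: drop_poly 1 P; exists Q.
  have PQ : P = (P`_0)%:P + drop_poly 1 P * 'X.
    rewrite -[LHS](poly_take_drop 1) expr1; congr (_ + _).
    by apply/polyP => [[|k]]; rewrite coef_take_poly coefC.
  have s2 : P`_0 * P`_0 = 1 by rewrite -expr2 -real_normK ?num_real // P0 expr1n.
  have : (map_poly intr P).[z] = 0 :> K by rewrite -intP (rootP rootz).
  rewrite {1}PQ rmorphD rmorphM /= map_polyC map_polyX hornerD hornerMX hornerC.
  move=> /eqP; rewrite addrC addr_eq0 => /eqP dE.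
  rewrite /Q linearZ /= hornerZ mulrCA [z * _]mulrC dE.
  by rewrite rmorphN /= mulrNN -rmorphM /= s2.
have z0 : z != 0.
  by apply: contra_eq_neq zE => ->; rewrite mul0r eq_sym oner_eq0.
have zVint : ring_of_integers z^-1.
  have -> : z^-1 = (map_poly intr zinv_poly).[z].
    by apply: (mulfI z0); rewrite mulfV // zE.
  apply: integral_horner; last exact: zint.
  by apply/integral_poly => i; rewrite coef_map; exact: integral_id.
by split.
Qed.
(** * Counting by finite codes *)

Section Counting.
Variables (R : realType) (T U : choiceType) (D : finType).
Variables (A : set T) (phi : T -> U) (psi : D -> U).

Lemma counting_le_card : {in A &, injective phi} ->
  (forall p, A p -> exists c, phi p = psi c) ->
  (counting A <= #|D|%:R%:E :> \bar R)%E.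
Proof.
move=> phi_inj cover.
have [->|/set0P[p0 Ap0]] := eqVneq A set0.
  by rewrite /counting asboolT // fset_set0 cardfs0 lee_fin.
have /boolp.choice[g gE] (c : D) : exists p, forall r, A r -> phi r = psi c -> r = p.
  have [[r [Ar rc]]|no] := boolp.pselect (exists r, A r /\ phi r = psi c).
    exists r => t At tc.
    by apply: phi_inj; [exact: mem_set|exact: mem_set|rewrite tc rc].
  by exists p0 => r Ar rc; case: no; exists r.
have Ag p : A p -> exists c, p = g c.
  by move=> Ap; have [c pc] := cover p Ap; exists c; exact: gE.
have Afin : finite_set A.
  apply: (@sub_finite_set _ _ (g @` [set: D])); last exact/finite_image/finite_finset.
  by move=> p /Ag[c ->]; exists c.
rewrite /counting asboolT // lee_fin ler_nat -(size_codom g).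
apply: uniq_leq_size; first exact: fset_uniq.
move=> p; rewrite in_fset_set // inE => /Ag[c ->]; exact: codom_f.
Qed.

Lemma card_le_counting : injective psi ->
  (forall c, exists2 p, A p & phi p = psi c) ->
  (#|D|%:R%:E <= counting A :> \bar R)%E.
Proof.
move=> psi_inj cover.
have /boolp.choice[g gE] (c : D) : exists p, A p /\ phi p = psi c.
  by have [p] := cover c; exists p.
rewrite /counting; case: asboolP => [Afin|_]; last exact: leey.
have g_inj : injective g.
  by move=> c c' cc'; apply: psi_inj; rewrite -(gE c).2 -(gE c').2 cc'.
rewrite lee_fin ler_nat -(size_codom g); apply: uniq_leq_size.
  exact/injectiveP.
by move=> _ /codomP[c ->]; rewrite in_fset_set // inE; exact: (gE c).1.
Qed.

End Counting.

(** A code describes an integer polynomial of degree n with leading coefficient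
    1 and constant term 1 or -1. It lists the sign of the constant term and,
    for each k, the sign and the absolute value of the coefficient of
    X^(n - k - 1), the latter in the progression N k, N k + q, ..., of length
    M k. Steps q = 1 and q = 2 serve the upper and the lower bound. *)
Section Codes.
Variables (n : nat) (N M : 'I_n.-1 -> nat) (q : nat).

Definition code : finType := (bool * {dffun forall k : 'I_n.-1, bool * 'I_(M k)})%type.

Lemma card_code : #|code| = (2 * \prod_(k < n.-1) (2 * M k))%N.
Proof.
rewrite card_prod card_bool; congr muln.
rewrite card_dep_ffun foldrE big_map big_enum /=.
by apply: eq_bigr => k _; rewrite card_prod card_bool card_ord.
Qed.

(** Coefficients are indexed from the leading one, to match elementary symmetric
    functions. At index n there is no ordinal of value [n.-1] in
    ['I_n.-1], so the last branch is the constant term. *)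
Definition code_coef (c : code) (k : nat) : int :=
  if k == 0 then 1 else
  if insub k.-1 is Some i then (-1) ^+ (c.2 i).1 * (N i + q * (c.2 i).2)%:Z
  else (-1) ^+ c.1.

Definition code_poly (c : code) : {poly int} :=
  \poly_(j < n.+1) code_coef c (n - j).

Lemma coef_code_poly c k : (k <= n)%N -> (code_poly c)`_(n - k) = code_coef c k.
Proof. by move=> kn; rewrite coef_poly ltnS leq_subr subKn. Qed.

Lemma code_coefS c (k : 'I_n.-1) :
  code_coef c k.+1 = (-1) ^+ (c.2 k).1 * (N k + q * (c.2 k).2)%:Z.
Proof. by rewrite /code_coef /= valK. Qed.

Lemma code_coefn c : (0 < n)%N -> code_coef c n = (-1) ^+ c.1.
Proof. by move=> n0; rewrite /code_coef gtn_eqF // insubF // ltnn. Qed.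

Lemma code_poly_inj : (0 < n)%N -> (0 < q)%N -> (forall k, 0 < N k)%N ->
  injective code_poly.
Proof.
move=> n0 q0 N0 [b f] [b' f'] E.
have cE k : (k <= n)%N -> code_coef (b, f) k = code_coef (b', f') k.
  by move=> kn; rewrite -!coef_code_poly // E.
congr pair.
  by have := cE n (leqnn n); rewrite !code_coefn //=; case: b b' {E cE} => [] [].
apply/ffunP => k; have := cE k.+1; rewrite !code_coefS /=.
case: (f k) => [s i]; case: (f' k) => [s' i'] /=.
have kn : (k < n)%N by apply: leq_trans (ltn_ord k) (leq_pred n).
move=> /(_ kn) H; have N0k := N0 k.
have [ss ii] : s = s' /\ i = i' :> nat.
  by move: H; case: s s' => [] []; rewrite /= ?mulN1r ?mul1r => H; split => //; nia.
by rewrite ss; congr pair; exact: val_inj.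
Qed.

Lemma code_polyP (P : {poly int}) : (0 < n)%N -> (size P <= n.+1)%N -> P`_n = 1 ->
  `|P`_0| = 1 ->
  (forall k : 'I_n.-1, exists j : 'I_(M k), `|P`_(n - k.+1)| = (N k + q * j)%:Z) ->
  exists c, P = code_poly c.
Proof.
move=> n0 szP Pn P0 Pk.
have sgn (z : int) (m : nat) : `|z| = m%:Z -> z = (-1) ^+ (z < 0)%R * m%:Z.
  by move=> <-; rewrite mulr_sign_norm.
have [j jE] : exists j : forall k, 'I_(M k),
    forall k : 'I_n.-1, `|P`_(n - k.+1)| = (N k + q * j k)%:Z.
  exists (fun k => projT1 (cid (Pk k))) => k; exact: projT2 (cid (Pk k)).
pose f : {dffun forall k : 'I_n.-1, bool * 'I_(M k)} :=
  finfun (fun k : 'I_n.-1 => (P`_(n - k.+1) < 0, j k) : bool * 'I_(M k)).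
exists (P`_0 < 0, f).
apply/polyP => i; rewrite coef_poly; case: ltnP => [|ni]; last first.
  by rewrite nth_default // (leq_trans szP).
rewrite ltnS => i_n; have -> : P`_i = P`_(n - (n - i)) by rewrite subKn.
move: (n - i)%N (leq_subr i n) => {i_n}i i_n.
have [->|i0] := eqVneq i 0%N; first by rewrite subn0.
have [->|in'] := eqVneq i n; first by rewrite code_coefn // subnn {1}(sgn _ 1%N P0) mulr1.
have i1 : (i.-1 < n.-1)%N by lia.
have -> : i = (Ordinal i1).+1 by move: i0 => /= i0; lia.
by rewrite code_coefS /= ffunE; exact: sgn (jE (Ordinal i1)).
Qed.

End Codes.

(** * Partial sums of the direction *)

Section Valuations.
Variables (R : realType) (n : nat).
Implicit Types (v : 'rV[R]_n) (T e d : R).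

Definition psum v (k : nat) : R := \sum_(i < n | (i < k)%N) v 0 i.

Lemma psumS v (k : 'I_n) : psum v k.+1 = psum v k + v 0 k.
Proof.
rewrite /psum (bigD1 k) //= addrC; congr (_ + _).
by apply: eq_bigl => i; rewrite ltnS [RHS]ltn_neqAle andbC.
Qed.

Lemma psum0 v : psum v 0 = 0.
Proof. by rewrite /psum big_pred0. Qed.

Lemma psum_full v : Hplus v -> psum v n = 0.
Proof. by move=> [v0 _]; rewrite -v0; apply: eq_bigl => i; rewrite ltn_ord. Qed.

(** If the entry of index k is nonnegative, those before it are positive. If it
    is negative, so are those after it, and the complementary sum, which is the
    opposite of V_k, is negative. *)
Lemma psum_gt0 v k : Hplus v -> (0 < k < n)%N -> 0 < psum v k.
Proof.
move=> [v0 vdec] /andP[k0 kn].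
pose k' := Ordinal kn; pose i0 := Ordinal (leq_ltn_trans (leq0n k) kn).
have [vk|vk] := leP 0 (v 0 k').
  rewrite /psum (bigD1 i0) //= ltr_pwDl //; first exact: le_lt_trans (vdec i0 k' k0).
  by apply: sumr_ge0 => i /andP[ik _]; rewrite (le_trans vk) // ltW // vdec.
have : psum v k + \sum_(i < n | ~~ (i < k)%N) v 0 i = 0.
  by rewrite -[RHS]v0 [RHS](bigID (fun i : 'I_n => (i < k)%N)).
move=> /eqP; rewrite addr_eq0 => /eqP ->; rewrite oppr_gt0.
rewrite (bigD1 k') /=; last by rewrite ltnn.
rewrite ltr_nwDl //; apply: sumr_le0 => i /andP[]; rewrite -leqNgt => ki ik.
rewrite ltW // (lt_trans _ vk) // vdec //=.
by rewrite ltn_neqAle ki andbT; apply: contra_neq ik => ki'; exact: val_inj.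
Qed.

(** Summation by parts: the entry of index i occurs in the partial sums of
    index greater than i. *)
Lemma growth_prod v T : growth v T = \prod_(k < n.-1) expR (T * psum v k.+1).
Proof.
rewrite /growth -expR_sum; congr expR.
under [RHS]eq_bigr do rewrite /psum mulr_sumr big_mkcond.
rewrite exchange_big /= [LHS]big_mkcond; apply: eq_bigr => i _.
rewrite -big_mkcond /=.
have -> : \sum_(k < n.-1 | (i < k.+1)%N) (T * v 0 i) = \sum_(i <= k < n.-1) (T * v 0 i).
  by rewrite big_geq_mkord.
rewrite sumr_const_nat -subn1 -subnDA add1n; case: ifPn => [_|].
  by rewrite -mulrA [LHS]mulr_natl mulrC.
by rewrite -leqNgt => /eqnP ->.
Qed.

Definition gap v d := forall i j : 'I_n, (i < j)%N -> v 0 j + d <= v 0 i.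

Lemma exists_gap v : Hplus v -> exists2 d, 0 < d & gap v d.
Proof.
move=> [_ vdec].
pose d := \big[Num.min/1]_(p : 'I_n * 'I_n | (p.1 < p.2)%N) (v 0 p.1 - v 0 p.2).
exists d.
  rewrite /d; elim/big_ind: _ => // [x y x0 y0|p p12]; first by rewrite lt_min x0.
  by rewrite subr_gt0 vdec.
move=> i j ij; rewrite -lerBrDl.
exact: (bigmin_le_cond _ (j := (i, j)) (fun p => v 0 p.1 - v 0 p.2)).
Qed.

(** After translation by v_k the entries before k are positive and those after k
    negative, so the prefix maximizes the sum over subsets. Each deviation from
    it, here at b, costs a term of size at least d. *)
Lemma subset_gap v d (I : {set 'I_n}) (k b : 'I_n) : 0 < d -> gap v d ->
  ((b < k)%N && (b \notin I)) || ((k < b)%N && (b \in I)) ->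
  \sum_(i in I) (v 0 i - v 0 k) <= \sum_(i < n | (i < k)%N) (v 0 i - v 0 k) - d.
Proof.
move=> d0 vd bad; rewrite -subr_ge0 addrAC.
rewrite [X in X - _ - _]big_mkcond [X in _ - X - _]big_mkcond -sumrB /= subr_ge0.
have vk (i : 'I_n) : (i < k)%N -> d <= v 0 i - v 0 k by move=> ik; rewrite lerBrDl vd.
have kv (i : 'I_n) : (k < i)%N -> d <= - (v 0 i - v 0 k).
  by move=> ik; rewrite opprB lerBrDl vd.
rewrite (bigD1 b) //= -[d]addr0 lerD //.
  move: bad; case: (ltngtP b k) => //= [/vk h|/kv h]; rewrite ?orbF.
    by move=> /negPf ->; rewrite subr0.
  by move=> ->; rewrite sub0r.
apply: sumr_ge0 => i _; case: (ltngtP i k) => [/vk|/kv|/val_inj ->].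
- by move=> h; case: ifP; rewrite ?subrr // subr0 (le_trans _ h) // ltW.
- by move=> h; case: ifP; rewrite ?subrr // sub0r (le_trans _ h) // ltW.
- by rewrite !subrr; case: ifP; rewrite ?subrr.
Qed.

Definition prefix (k : nat) : {set 'I_n} := [set i : 'I_n | (i < k)%N].

Lemma psumE v k : psum v k = \sum_(i in prefix k) v 0 i.
Proof. by apply: eq_bigl => i; rewrite inE. Qed.

Lemma card_prefix k : (k <= n)%N -> #|prefix k| = k.
Proof.
move=> kn; rewrite -sum1_card.
under eq_bigl do rewrite inE.
by rewrite -(big_ord_widen n (fun=> 1%N)) // sum1_card card_ord.
Qed.

Lemma sum_prefixB v k (c : R) : (k <= n)%N ->
  \sum_(i < n | (i < k)%N) (v 0 i - c) = psum v k - k%:R * c.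
Proof.
move=> kn; rewrite sumrB; congr (_ - _).
rewrite -[in RHS](card_prefix kn) mulr_natl -sumr_const.
by apply: eq_bigl => i; rewrite inE.
Qed.

(** The function of j on the left-hand side is concave, with its maximum reached
    at k and at k + 1. *)
Lemma psum_gap v d (k : 'I_n) (j : nat) : 0 < d -> gap v d -> (j <= n)%N ->
  j != k -> j != k.+1 ->
  psum v j - j%:R * v 0 k <= psum v k - k%:R * v 0 k - d.
Proof.
move=> d0 vd jn jk jk1.
rewrite -!sum_prefixB //; last exact: ltnW.
have -> : \sum_(i < n | (i < j)%N) (v 0 i - v 0 k) =
    \sum_(i in prefix j) (v 0 i - v 0 k) by apply: eq_bigl => i; rewrite inE.
move: jk; rewrite neq_ltn => /orP[jk|kj].
  apply: (@subset_gap _ _ _ _ (Ordinal (ltn_trans jk (ltn_ord k)))) => //=.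
  by rewrite jk inE /= ltnn.
have {jk1}kj : (k.+1 < j)%N by rewrite ltn_neqAle eq_sym jk1.
apply: (@subset_gap _ _ _ _ (Ordinal (leq_trans kj jn))) => //=.
by rewrite ltnSn inE /= kj orbT.
Qed.

(** A set of k indices other than the first k misses one of these. *)
Lemma sum_subset_gap v d (k : 'I_n) (I : {set 'I_n}) : 0 < d -> gap v d ->
  #|I| = k -> I != prefix k -> \sum_(i in I) v 0 i <= psum v k - d.
Proof.
move=> d0 vd Ik Ipre.
have [b bk bI] : exists2 b : 'I_n, (b < k)%N & b \notin I.
  have : ~~ (prefix k \subset I).
    apply: contra Ipre => sub; rewrite eq_sym eqEcard sub Ik card_prefix ?leqnn //.
    by rewrite ltnW.
  by move=> /subsetPn[b]; rewrite inE => bk bI; exists b.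
have := @subset_gap _ _ I k b d0 vd; rewrite bk bI => /(_ isT).
rewrite sum_prefixB; last exact: ltnW.
by rewrite sumrB sumr_const Ik mulr_natl addrAC lerD2r.
Qed.

(** * Sizes of the coefficients *)

Lemma coef_prod_XsubC_ord (F : 'I_n -> R) k : (k <= n)%N ->
  (\prod_(i < n) ('X - (F i)%:P))`_(n - k) =
  (-1) ^+ k * \sum_(I : {set 'I_n} | #|I| == k) \prod_(i in I) F i.
Proof.
move=> kn; under eq_bigr do rewrite addrC -polyCN.
rewrite bigA_distr coef_sum mulr_sumr [RHS]big_mkcond; apply: eq_bigr => I _.
rewrite (bigID (mem I)) /=.
under eq_bigr => i -> do [].
under [X in _ * X]eq_bigr => i /negPf -> do [].
rewrite prodr_const -rmorph_prod coefCM coefXn prodrN.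
have cI : (#|I| + #|[predC I]| = n)%N by rewrite cardC card_ord.
have -> : (#|[predC I]| = n - #|I|)%N by rewrite -[X in (X - _)%N]cI addKn.
case: (#|I| =P k) => [->|Ik]; first by rewrite eqxx mulr1.
case: eqP; rewrite ?mulr0 // => nI; case: Ik.
have := max_card (mem I); rewrite card_ord => In; lia.
Qed.

Section NearDirection.
Variables (v : 'rV[R]_n) (d T e : R) (w : 'I_n -> R).
Hypotheses (d_gt0 : 0 < d) (vd : gap v d) (T_ge0 : 0 <= T).
Hypotheses (w_neq0 : forall i, w i != 0)
  (w_near : forall i, `|ln `|w i| - T * v 0 i| < e).

Lemma prod_norm_near (I : {set 'I_n}) :
  expR (T * (\sum_(i in I) v 0 i) - #|I|%:R * e) <= \prod_(i in I) `|w i|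
    <= expR (T * (\sum_(i in I) v 0 i) + #|I|%:R * e).
Proof.
have -> : \prod_(i in I) `|w i| = expR (\sum_(i in I) ln `|w i|).
  by rewrite expR_sum; apply: eq_bigr => i _; rewrite lnK // posrE normr_gt0.
rewrite !ler_expR mulr_sumr !mulr_natl -!sumr_const -sumrB -big_split /=.
by apply/andP; split; apply: ler_sum => i _; move: (w_near i);
  rewrite ltr_norml => /andP[h1 h2]; lra.
Qed.

(** In the elementary symmetric function of degree k, each of the at most 2^n
    products other than that over the first k indices loses exp (- T d). *)
Lemma coef_near (k : 'I_n) :
  `| `|(\prod_(i < n) ('X - (w i)%:P))`_(n - k)| - \prod_(i in prefix k) `|w i| |
  <= expR (T * psum v k) * (2 ^+ n * expR (k%:R * e - T * d)).
Proof.
rewrite coef_prod_XsubC_ord; last exact: ltnW.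
rewrite normrMsign -normr_prod; apply: le_trans (ler_dist_dist _ _) _.
rewrite (bigD1 (prefix k)) /=; last by rewrite card_prefix // ltnW.
rewrite addrC addrK; apply: le_trans (ler_norm_sum _ _ _) _.
apply: (@le_trans _ _ (\sum_(I : {set 'I_n}) expR (T * (psum v k - d) + k%:R * e))).
  rewrite big_mkcond; apply: ler_sum => I _.
  case: ifPn => [/andP[/eqP Ik Ipre]|_]; last exact: expR_ge0.
  rewrite normr_prod; have /andP[_] := prod_norm_near I; move=> /le_trans -> //.
  by rewrite ler_expR Ik lerD2r ler_wpM2l // sum_subset_gap.
rewrite (eq_bigl [in powerset (finset.setT : {set 'I_n})]); last first.
  by move=> I; rewrite powersetE finset.subsetT.
rewrite sumr_const card_powerset cardsT card_ord -[leLHS]mulr_natl natrX.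
rewrite [leRHS]mulrCA -expRD.
by rewrite ler_pM2l ?exprn_gt0 // ler_expR; lra.
Qed.

End NearDirection.

(** * The upper count *)

Lemma mx_norm_LambdaP v T e (w : 'rV[R]_n) : 0 < e ->
  mx_norm (Lambda w - T *: v) < e <->
  forall i, `|ln `|w 0 i| - T * v 0 i| < e.
Proof.
move=> e0; rewrite mx_normrE; split=> [/bigmax_ltP[_ we] i|we].
  by have := we (0, i) isT; rewrite !mxE.
by apply/bigmax_ltP; split=> // -[i j] _; rewrite (ord1 i) !mxE.
Qed.

Lemma near_index_uniq v d T e (a : R) (i j : 'I_n) : gap v d -> 0 < d -> 2 * e <= d ->
  1 <= T -> `|a - T * v 0 i| < e -> `|a - T * v 0 j| < e -> i = j.
Proof.
move=> vd d0 ed T1.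
wlog ij : i j / (i < j)%N.
  move=> H hi hj; case: (ltngtP i j) => [ij|ji|/val_inj //]; first exact: H.
  by apply/esym/H.
rewrite !ltr_norml => /andP[h1 _] /andP[_ h2].
move: (vd i j ij) h1 h2; move: (v 0 i) (v 0 j) => x y h1 h2 h3.
have : 0 <= (T - 1) * (x - y) by apply: mulr_ge0; lra.
by move=> h4; exfalso; lra.
Qed.

Definition near_units v e T : set (set 'rV[R]_n * 'rV[R]_n)%type :=
  [set p | On_units p /\ mx_norm (Lambda p.2 - T *: v) < e].

Definition poly_of_roots (w : 'rV[R]_n) : {poly R} := \prod_(i < n) ('X - (w 0 i)%:P).

(** Each root of the polynomial is close to T v_i for a single i, so the
    polynomial determines the ordered vector of its roots. *)
Lemma near_units_inj v d T e : gap v d -> 0 < d -> 0 < e -> 2 * e <= d ->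
  1 <= T -> {in near_units v e T &, injective (fun p => poly_of_roots p.2)}.
Proof.
move=> vd d0 e0 ed T1 p q; rewrite !inE => -[pU /(mx_norm_LambdaP _ _ _ e0) pn].
move=> [qU /(mx_norm_LambdaP _ _ _ e0) qn] pq.
have pinj : injective (p.2 0).
  move=> i j ij; apply: (near_index_uniq vd d0 ed T1 (pn i)).
  by rewrite ij pn.
apply: On_units_snd_inj => //; apply/rowP => i.
have : root (poly_of_roots q.2) (p.2 0 i).
  rewrite -pq rootE horner_prod; apply/prodf_eq0; exists i => //.
  by rewrite hornerXsubC subrr.
rewrite rootE horner_prod => /prodf_eq0[j _].
rewrite hornerXsubC subr_eq0 => /eqP pqij.
rewrite pqij; congr (q.2 0 _); apply/esym.
apply: (near_index_uniq vd d0 ed T1 (pn i)).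
by rewrite pqij qn.
Qed.

Lemma monic_poly_of_roots w : poly_of_roots w \is monic.
Proof. exact: monic_prod_XsubC. Qed.

Lemma size_poly_of_roots w : size (poly_of_roots w) = n.+1.
Proof. by rewrite size_prod_XsubC /index_enum -enumT size_enum_ord. Qed.

(** By [prod_norm_near] and [coef_near] the absolute value of the coefficient of
    X^(n-k), divided by exp (T V_k), lies in an interval whose length is the sum
    of all the terms but the last. The last one accounts for rounding the end
    points to integers. *)
Definition coef_window v d e T (k : nat) : R :=
  expR (k%:R * e) - expR (- (k%:R * e)) +
  2 * (2 ^+ n * expR (k%:R * e - T * d)) + 2 * expR (- (T * psum v k)).

(** Each coefficient is coded by its sign and by its offset from the lower end of
    its window. *)
Lemma unit_count_le v d e T : (1 < n)%N -> gap v d -> 0 < d -> 0 < e -> 2 * e <= d ->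
  1 <= T ->
  (unit_count v e T <=
    (2 * \prod_(k < n.-1) (2 * coef_window v d e T k.+1) * growth v T)%:E)%E.
Proof.
move=> n1 vd d0 e0 ed T1; have T0 : 0 <= T by apply: le_trans T1.
have n0 : (0 < n)%N by exact: ltnW.
pose eta (k : nat) := 2 ^+ n * expR (k%:R * e - T * d) : R.
pose lo k := expR (T * psum v k) * (expR (- (k%:R * e)) - eta k).
pose hi k := expR (T * psum v k) * (expR (k%:R * e) + eta k).
(* A negative [lo] is truncated to 0, still a lower bound for the absolute
   value of a coefficient. *)
pose N (k : 'I_n.-1) := Num.truncn (lo k.+1).
pose M (k : 'I_n.-1) := (Num.truncn (hi k.+1 - lo k.+1 + 1)).+1.
have lohi k : lo k <= hi k.
  rewrite ler_pM2l ?expR_gt0 //.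
  have e1 : expR (- (k%:R * e)) <= expR (k%:R * e).
    by rewrite ler_expR -subr_ge0 opprK addr_ge0 // mulr_ge0 // ltW.
  have e2 : 0 <= eta k by rewrite mulr_ge0 ?exprn_ge0 ?expR_ge0.
  lra.
apply: (@le_trans _ _ (#|code M|%:R%:E)).
  apply: (@counting_le_card R _ _ _ (near_units v e T) (fun p => poly_of_roots p.2)
     (fun c => map_poly intr (code_poly N 1 c))).
    exact: near_units_inj vd d0 e0 ed T1.
  move=> p pA; have [pU /(mx_norm_LambdaP _ _ _ e0) pn] := pA.
  have pinj : injective (p.2 0).
    move=> i j ij; apply: (near_index_uniq vd d0 ed T1 (pn i)).
    by rewrite ij pn.
  have [P [PE P0 pneq0]] := On_units_int_poly pU pinj.
  have szP : size P = n.+1.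
    rewrite -(size_poly_of_roots p.2) /poly_of_roots PE size_map_inj_poly //.
    exact: intr_inj.
  have [||k|c Pc] := @code_polyP _ N M 1 P n0 _ _ P0; last by exists c; rewrite /= -Pc.
  - by rewrite szP.
  - apply: (@intr_inj R); rewrite -coef_map -PE.
    by have := monicP (monic_poly_of_roots p.2); rewrite /lead_coef size_poly_of_roots.
  have kn : (k.+1 < n)%N by have := ltn_ord k; lia.
  have := coef_near d0 vd T0 pneq0 pn (Ordinal kn).
  have := prod_norm_near pneq0 pn (prefix k.+1).
  rewrite card_prefix; last exact: ltnW.
  rewrite -psumE -/(poly_of_roots p.2) /poly_of_roots PE coef_map /= -/(eta _) !expRD.
  set z := P`_(n - k.+1); set X := \prod_(i in _) _.
  move=> /andP[X1 X2]; rewrite ler_distl => /andP[z1 z2].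
  have zE : `|z%:~R| = (`|z|%N)%:R :> R by rewrite natr_absz intr_norm.
  have zlo : lo k.+1 <= (`|z|%N)%:R by rewrite -zE /lo; lra.
  have zhi : (`|z|%N)%:R <= hi k.+1 by rewrite -zE /hi; lra.
  have Nz : (N k <= `|z|)%N by rewrite truncn_le_nat (le_lt_trans zlo) // ltr_nat.
  have jM : (`|z| - N k < M k)%N.
    rewrite ltnS truncn_ge_nat; last by rewrite addr_ge0 // subr_ge0 lohi.
    rewrite natrB //.
    have := truncnS_gt (lo k.+1); rewrite -/(N k) -natr1; lra.
  by exists (Ordinal jM); rewrite /= mul1n subnKC // abszE.
rewrite card_code lee_fin growth_prod -mulrA -big_split natrM ler_pM2l // natr_prod.
apply: ler_prod => k _; rewrite ler0n /= natrM -mulrA ler_pM2l //.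
rewrite /M.
have h : (Num.truncn (hi k.+1 - lo k.+1 + 1))%:R <= hi k.+1 - lo k.+1 + 1.
  by rewrite truncn_le // addr_ge0 ?subr_ge0.
rewrite -natr1; apply: le_trans (lerD h (lexx 1)) _.
rewrite /hi /lo /coef_window -/(eta k.+1).
have : expR (- (T * psum v k.+1)) * expR (T * psum v k.+1) = 1.
  by rewrite -expRD addNr expR0.
nra.
Qed.

(** * Real roots from the sizes of the coefficients *)

Lemma dominant_term_sign (Q : {poly R}) (x : R) (m : nat) : (m <= n)%N ->
  (size Q <= n.+1)%N ->
  \sum_(j < n.+1 | j != m :> nat) `|Q`_(n - j) * x ^+ (n - j)| <
    `|Q`_(n - m) * x ^+ (n - m)| ->
  0 < Q.[x] * (Q`_(n - m) * x ^+ (n - m)).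
Proof.
move=> mn szQ dom.
rewrite (horner_coef_wide _ szQ) (reindex_inj rev_ord_inj) /=.
under eq_bigr do rewrite subSS.
have mn1 : (m < n.+1)%N by [].
rewrite (bigD1 (Ordinal mn1)) //=.
set t := Q`_(n - m) * _ in dom *.
set s := (X in (_ + X) * _).
have : `|s| < `|t| by apply: le_lt_trans dom; exact: ler_norm_sum.
move=> st; have t0 : 0 < `|t| by apply: le_lt_trans st.
have : - s * t < t * t.
  apply: le_lt_trans (ler_norm _) _.
  by rewrite normrM normrN -[ltRHS]expr2 -real_normK ?num_real // expr2 ltr_pM2r.
by rewrite mulrDl; lra.
Qed.

Section RealRoots.
Variables (v : 'rV[R]_n) (d T e' delta : R) (P : {poly R}).
Hypotheses (d_gt0 : 0 < d) (vd : gap v d) (T_ge0 : 0 <= T).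
Hypotheses (delta_ge0 : 0 <= delta) (delta_lt : 2 * delta < e').
Hypotheses (szP : size P = n.+1).
Hypotheses (P_near : forall k, (k <= n)%N ->
  expR (T * psum v k - delta) <= `|P`_(n - k)| <= expR (T * psum v k + delta)).
Hypotheses (large : expR (2 * delta - e') +
  n.+1%:R * expR (2 * delta + n%:R * e' - T * d) < 1).

(** At |x| = exp (T v_k + r) the j-th term has logarithmic size
    n T v_k + T (V_j - j v_k) + (n - j) r up to delta. By [psum_gap] the indices
    k and k + 1 beat all the others by T d. The sign of r decides between these
    two, by the factor exp (e' - 2 delta). *)
Lemma sign_near (k : 'I_n) (m m' : nat) (r x : R) :
  ((m == k) && (m' == k.+1)) || ((m == k.+1) && (m' == k)) ->
  `|r| = e' -> (m%:R - m'%:R) * r = - e' -> `|x| = expR (T * v 0 k + r) ->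
  0 < P.[x] * (P`_(n - m) * x ^+ (n - m)).
Proof.
move=> mm' rE mr xE.
have kn := ltn_ord k.
have mn : (m <= n)%N by case/orP: mm' => /andP[/eqP -> _] //; exact: ltnW.
have m'n : (m' <= n)%N by case/orP: mm' => /andP[_ /eqP ->] //; exact: ltnW.
apply: dominant_term_sign => //; first by rewrite szP.
pose L (j : nat) := T * psum v j + (n - j)%:R * (T * v 0 k + r).
have term j : (j <= n)%N -> expR (L j - delta) <= `|P`_(n - j) * x ^+ (n - j)|
    <= expR (L j + delta).
  move=> jn; rewrite normrM normrX xE -expRM_natl.
  have -> : L j - delta = (T * psum v j - delta) + (n - j)%:R * (T * v 0 k + r).
    by rewrite /L; ring.
  have -> : L j + delta = (T * psum v j + delta) + (n - j)%:R * (T * v 0 k + r).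
    by rewrite /L; ring.
  rewrite [expR (_ - delta + _)]expRD [expR (_ + delta + _)]expRD.
  by rewrite !ler_pM2r ?expR_gt0 // P_near.
have step j : (j <= n)%N -> `|P`_(n - j) * x ^+ (n - j)| <=
    `|P`_(n - m) * x ^+ (n - m)| * expR (L j - L m + 2 * delta).
  move=> jn; have /andP[_ h1] := term _ jn; have /andP[h2 _] := term _ mn.
  apply: le_trans h1 _; apply: le_trans (ler_wpM2r (expR_ge0 _) h2).
  by rewrite -expRD ler_expR; lra.
have psumk : psum v k.+1 = psum v k + v 0 k by exact: psumS.
have cm : psum v m - m%:R * v 0 k = psum v k - k%:R * v 0 k.
  by case/orP: mm' => /andP[/eqP -> _] //; rewrite psumk -natr1; ring.
have cm' : psum v m' - m'%:R * v 0 k = psum v k - k%:R * v 0 k.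
  by case/orP: mm' => /andP[_ /eqP ->] //; rewrite psumk -natr1; ring.
have LE j : (j <= n)%N -> L j - L m =
    T * ((psum v j - j%:R * v 0 k) - (psum v m - m%:R * v 0 k)) + (m%:R - j%:R) * r.
  by move=> jn; rewrite /L !natrB //; ring.
have := large; set E1 := expR (2 * delta - e'); set E2 := expR (_ - T * d) => E12.
set t := `|P`_(n - m) * _| in step *.
have t0 : 0 < t.
  by have /andP[+ _] := term _ mn; apply: lt_le_trans; exact: expR_gt0.
apply: (@le_lt_trans _ _ (\sum_(j < n.+1) (t * ((j == m' :> nat)%:R * E1 + E2)))).
  rewrite [leLHS]big_mkcond; apply: ler_sum => -[j jn1] _ /=.
  have E10 : 0 <= E1 by exact: expR_ge0.
  have E20 : 0 <= E2 by exact: expR_ge0.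
  case: ifPn => [jm|_]; last by rewrite mulr_ge0 ?(ltW t0) // addr_ge0 // mulr_ge0.
  have jn : (j <= n)%N by [].
  apply: le_trans (step j jn) _; rewrite ler_pM2l //.
  have [->|jm'] := eqVneq j m'.
    rewrite mul1r LE // cm' cm subrr mulr0 add0r mr -[leLHS]addr0 lerD //.
    by rewrite ler_expR; lra.
  rewrite mul0r add0r ler_expR LE //.
  have jk : j != k by case/orP: mm' jm jm' => /andP[/eqP -> /eqP ->].
  have jk1 : j != k.+1 by case/orP: mm' jm jm' => /andP[/eqP -> /eqP ->].
  have := psum_gap d_gt0 vd jn jk jk1; rewrite -cm => h.
  have h2 : T * ((psum v j - j%:R * v 0 k) - (psum v m - m%:R * v 0 k)) <= T * (- d).
    by apply: ler_wpM2l => //; lra.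
  have h3 : (m%:R - j%:R) * r <= n%:R * e'.
    apply: le_trans (ler_norm _) _; rewrite normrM rE ler_wpM2r -?rE //.
    have : (m%:R <= n%:R :> R) && (j%:R <= n%:R :> R) by rewrite !ler_nat mn.
    move=> /andP[mR jR]; have := ler0n R m; have := ler0n R j => j0 m0.
    by rewrite ler_norml; apply/andP; split; lra.
  lra.
rewrite -mulr_sumr gtr_pMr // big_split /= -mulr_suml sumr_const card_ord.
apply: le_lt_trans E12.
rewrite -[E2 *+ _]mulr_natl lerD2r -[leRHS]mul1r ler_wpM2r ?expR_ge0 //.
have m'n1 : (m' < n.+1)%N by [].
rewrite (bigD1 (Ordinal m'n1)) //= eqxx big1 ?addr0 // => i.
by rewrite -val_eqE /= => /negPf ->.
Qed.

(** At the two ends of the interval the dominant terms have consecutive degrees.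
    The sign s of x is chosen so that they have opposite signs. *)
Lemma exists_root_near (k : 'I_n) :
  exists2 x : R, root P x & `|ln `|x| - T * v 0 k| <= e'.
Proof.
have e'0 : 0 <= e' by rewrite ltW // (le_lt_trans _ delta_lt) // mulr_ge0.
have kn := ltn_ord k.
have nz j : (j <= n)%N -> P`_(n - j) != 0.
  move=> jn; have /andP[+ _] := P_near jn.
  by rewrite -normr_gt0; apply: lt_le_trans; exact: expR_gt0.
pose s := - Num.sg (P`_(n - k) * P`_(n - k.+1)).
have s1 : `|s| = 1 by rewrite normrN normr_sg mulf_neq0 // nz // ltnW.
have s2 : s * s = 1 by rewrite -expr2 -real_normK ?num_real // s1 expr1n.
pose a := expR (T * v 0 k - e'); pose b := expR (T * v 0 k + e').
have ab : a <= b by rewrite ler_expR; lra.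
have a0 : 0 < a by exact: expR_gt0.
have b0 : 0 < b by exact: expR_gt0.
have ha : 0 < P.[s * a] * (P`_(n - k.+1) * (s * a) ^+ (n - k.+1)).
  apply: (@sign_near k k.+1 k (- e')); rewrite ?eqxx ?orbT //.
  - by rewrite normrN ger0_norm.
  - by rewrite -natr1; lra.
  - by rewrite normrM s1 mul1r gtr0_norm.
have hb : 0 < P.[s * b] * (P`_(n - k) * (s * b) ^+ (n - k)).
  apply: (@sign_near k k k.+1 e'); rewrite ?eqxx ?orbT //.
  - by rewrite ger0_norm.
  - by rewrite -natr1; lra.
  - by rewrite normrM s1 mul1r gtr0_norm.
have sgab : P.[s * a] * P.[s * b] <= 0.
  have := mulr_gt0 ha hb.
  rewrite mulrACA [X in _ * X]mulrACA [P`_(n - k.+1) * _]mulrC.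
  have nk : (n - k = (n - k.+1).+1)%N by lia.
  have c0 : P`_(n - k) * P`_(n - k.+1) != 0 by rewrite mulf_neq0 // nz // ltnW.
  rewrite {1 2}nk.
  set u := (n - k.+1)%N.
  have -> : (s * a) ^+ u * (s * b) ^+ u.+1 = s * (a ^+ u * b ^+ u.+1).
    rewrite [(s * b) ^+ _]exprS mulrCA -exprMn.
    have -> : s * a * (s * b) = (s * s) * (a * b) by ring.
    by rewrite s2 mul1r exprMn exprS -mulrA; congr (s * _); rewrite mulrCA.
  rewrite [_ * (s * _)]mulrA mulrA pmulr_lgt0; last by rewrite !mulr_gt0 ?exprn_gt0.
  move=> h; apply/ltW; move: h; rewrite nmulr_lgt0 //.
  rewrite /s -nk mulrN [_ * Num.sg _]mulrC -normrEsg.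
  by rewrite oppr_lt0 normr_gt0.
pose Q := P \Po (s *: 'X).
have QE y : Q.[y] = P.[s * y] by rewrite horner_comp hornerZ hornerX.
have [y yab /rootP yroot] : {y | y \in `[a, b] & root Q y}.
  by apply: polyrcf.poly_ivt; rewrite ?QE.
move: yab; rewrite in_itv /= => /andP[ay yb].
have y0 : 0 < y by apply: lt_le_trans ay.
exists (s * y); first by apply/rootP; rewrite -QE.
rewrite normrM s1 mul1r gtr0_norm // ler_distl.
by rewrite -[_ - e']expRK -[_ + e']expRK !ler_ln ?posrE ?expR_gt0 // ay.
Qed.

End RealRoots.

(** * The lower count *)

Lemma exists_near_unit v d T e e' delta (P : {poly int}) :
  Hplus v -> 0 < d -> gap v d -> 1 <= T -> 0 <= delta -> 2 * delta < e' ->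
  e' < e -> 2 * e <= d ->
  expR (2 * delta - e') + n.+1%:R * expR (2 * delta + n%:R * e' - T * d) < 1 ->
  P \is monic -> size P = n.+1 -> irreducible_poly (pZtoQ P) -> `|P`_0| = 1 ->
  (forall k : 'I_n.-1, expR (T * psum v k.+1 - delta) <= `|P`_(n - k.+1)|%:~R
     <= expR (T * psum v k.+1 + delta)) ->
  exists2 p, near_units v e T p & poly_of_roots p.2 = map_poly intr P.
Proof.
move=> hv d0 vd T1 delta0 delta_lt e'e ed large Pmon szP irrP P0 Pnear.
have T0 : 0 <= T by apply: le_trans T1.
have e0 : 0 < e.
  by rewrite (lt_trans _ e'e) // (le_lt_trans _ delta_lt) // mulr_ge0.
pose Q : {poly R} := map_poly intr P.
have szQ : size Q = n.+1 by rewrite size_map_inj_poly //; exact: intr_inj.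
have Qnear k : (k <= n)%N ->
    expR (T * psum v k - delta) <= `|Q`_(n - k)| <= expR (T * psum v k + delta).
  have one : expR (T * 0 - delta) <= 1 <= expR (T * 0 + delta).
    by rewrite -expR0 !ler_expR mulr0 !add0r oppr_le0 delta0.
  move=> kn; rewrite coef_map /= -intr_norm.
  have [->|k0] := eqVneq k 0%N.
    rewrite psum0 subn0; have := monicP Pmon; rewrite /lead_coef szP /= => ->.
    by rewrite normr1.
  have [->|kn'] := eqVneq k n; first by rewrite subnn P0 psum_full.
  have k1 : (k.-1 < n.-1)%N by lia.
  by have := Pnear (Ordinal k1); rewrite /= prednK // lt0n.
have roots (k : 'I_n) : exists x, root Q x /\ `|ln `|x| - T * v 0 k| <= e'.
  by have [x] := exists_root_near d0 vd T0 delta0 delta_lt szQ Qnear large k; exists x.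
have [x xE] := boolp.choice roots.
pose w : 'rV[R]_n := \row_i x i.
have wn i : `|ln `|w 0 i| - T * v 0 i| < e.
  by rewrite mxE; apply: le_lt_trans e'e; exact: (xE i).2.
have winj : injective (w 0).
  move=> i j ij; apply: (near_index_uniq vd d0 ed T1 (wn i)).
  by rewrite ij wn.
have QE : poly_of_roots w = Q.
  have Qmon : Q \is monic by rewrite monic_map.
  have : Q = lead_coef Q *: \prod_(z <- [seq w 0 i | i <- enum 'I_n]) ('X - z%:P).
    apply: all_roots_prod_XsubC.
    - by rewrite szQ size_map size_enum_ord.
    - by apply/allP => _ /mapP[i _ ->]; rewrite mxE; exact: (xE i).1.
    - by rewrite uniq_rootsE map_inj_uniq // enum_uniq.
  by rewrite (monicP Qmon) scale1r big_map big_enum.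
have [A AU] := On_units_of_poly Pmon irrP P0 QE winj.
by exists (A, w) => //; split=> //; apply/mx_norm_LambdaP.
Qed.

(** An interval of length L contains at least L / 2 - 1 integers of a given
    parity. The parities are those of an irreducible polynomial over F_2, whose
    constant term is 1, so that the constant terms 1 and -1 are both
    available. *)
Lemma unit_count_ge v d T e e' delta :
  (1 < n)%N -> Hplus v -> 0 < d -> gap v d -> 1 <= T -> 0 < delta ->
  2 * delta < e' -> e' < e -> 2 * e <= d ->
  expR (2 * delta - e') + n.+1%:R * expR (2 * delta + n%:R * e' - T * d) < 1 ->
  (forall k : 'I_n.-1, 2 * expR (- (T * psum v k.+1)) <= expR delta - expR (- delta)) ->
  ((2 * \prod_(k < n.-1)
      (expR delta - expR (- delta) - 2 * expR (- (T * psum v k.+1))) *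
    growth v T)%:E <= unit_count v e T)%E.
Proof.
move=> n1 hv d0 vd T1 delta0 delta_lt e'e ed large Mlarge.
have n0 : (0 < n)%N by exact: ltnW.
have [f [fmon szf irrf]] := @exists_irreducible_Fp 2 n isT n0.
pose lo k : R := expR (T * psum v k - delta).
pose hi k : R := expR (T * psum v k + delta).
pose t k := (Num.truncn (lo k)).+1.
pose b k : nat := val f`_(n - k).
(* The first integer from [t] on that has the parity of [b]. *)
pose N (k : 'I_n.-1) := (t k.+1 + (t k.+1 + b k.+1) %% 2)%N.
pose M (k : 'I_n.-1) := Num.truncn ((hi k.+1 - lo k.+1) / 2).
have lo0 k : 0 < lo k by exact: expR_gt0.
have lohi k : lo k <= hi k by rewrite ler_expR; lra.
have f0 : f`_0 = 1.
  have : f`_0 != 0.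
    apply/negP => /eqP f00.
    have Xf : 'X %| f.
      by rewrite -['X]subr0 -polyC0 dvdp_XsubCl rootE horner_coef0 f00.
    have := eqp_size (irrf.2 'X _ Xf); rewrite size_polyX szf => /(_ isT) [].
    by move=> n1'; move: n1; rewrite -n1'.
  by case: (f`_0) => [[|[|m]] im] //= _; apply/val_inj.
apply: (@le_trans _ _ (#|code M|%:R%:E)); last first.
  apply: (@card_le_counting R _ _ _ (near_units v e T) (fun p => poly_of_roots p.2)
     (fun c => map_poly intr (code_poly N 2 c))).
    move=> c c' /map_inj_poly cc'; apply: (code_poly_inj n0 (q := 2) (N := N)) => //.
    by apply: cc' => //; exact: intr_inj.
  move=> c.
  have P_n : (code_poly N 2 c)`_n = 1.
    by have := coef_code_poly N 2 c (leq0n n); rewrite subn0.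
  have P_0 : (code_poly N 2 c)`_0 = (-1) ^+ c.1.
    by have := coef_code_poly N 2 c (leqnn n); rewrite subnn code_coefn.
  have szP : size (code_poly N 2 c) = n.+1.
    apply: size_poly_eq; rewrite subnn; exact: oner_neq0.
  have Pmon : code_poly N 2 c \is monic by rewrite monicE /lead_coef szP /= P_n.
  apply: (exists_near_unit hv d0 vd T1 (ltW delta0) delta_lt e'e ed large) => //.
  - apply: (@irreducible_of_reduction 'F_2 intr) => //.
    suff -> : map_poly intr (code_poly N 2 c) = f by [].
    apply/polyP => j; rewrite coef_map /=.
    have [jn|nj] := leqP j n; last by rewrite !nth_default ?szP ?szf // rmorph0.
    have -> : j = (n - (n - j))%N by rewrite subKn.
    move: (n - j)%N (leq_subr j n) => {jn}k kn; rewrite coef_code_poly //.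
    have sgn2 (s : bool) : ((-1) ^+ s)%:~R = 1 :> 'F_2.
      by rewrite rmorph_sign; apply/val_inj; case: s.
    have [->|k0] := eqVneq k 0%N.
      by have := monicP fmon; rewrite /lead_coef szf subn0 => ->.
    have [->|kn'] := eqVneq k n; first by rewrite code_coefn // subnn f0 sgn2.
    have k1 : (k.-1 < n.-1)%N by lia.
    have kE : k = (Ordinal k1).+1 by rewrite /= prednK // lt0n.
    rewrite {1}kE code_coefS rmorphM /= sgn2 mul1r.
    apply/val_inj; rewrite /= (@val_Fp_nat 2) // /N -kE.
    have : (b k < 2)%N by exact: ltn_ord.
    rewrite -/(b k); move: (b k) (t k) (nat_of_ord _) => bk tk i bk2; lia.
  - by rewrite P_0 normr_sign.
  move=> k; have kn : (k.+1 <= n)%N by have := ltn_ord k; lia.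
  rewrite coef_code_poly // code_coefS normrMsign.
  set j := (c.2 k).2; set m := (N k + 2 * j)%N.
  have -> : `|m%:Z|%:~R = m%:R :> R by [].
  have tN : (t k.+1 <= N k <= t k.+1 + 1)%N.
    by rewrite leq_addr leq_add2l -ltnS ltn_mod.
  have t1 : lo k.+1 < (t k.+1)%:R by exact: truncnS_gt.
  have t2 : (t k.+1)%:R <= lo k.+1 + 1.
    by rewrite /t -natr1 lerD2r truncn_le // ltW.
  have jM : (j.+1)%:R <= (hi k.+1 - lo k.+1) / 2.
    by rewrite -truncn_ge_nat ?divr_ge0 ?subr_ge0 ?lohi //; exact: ltn_ord.
  move/andP: tN; rewrite -!(ler_nat R) natrD => -[N1 N2].
  rewrite -[j.+1%:R]natr1 in jM.
  by rewrite /m natrD natrM; apply/andP; split; rewrite -/(lo _) -/(hi _);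
    have := ler0n R j; lra.
rewrite card_code lee_fin growth_prod -mulrA -big_split natrM ler_pM2l // natr_prod.
apply: ler_prod => k _; rewrite mulr_ge0 ?expR_ge0 ?subr_ge0 ?Mlarge //= natrM.
have := truncnS_gt ((hi k.+1 - lo k.+1) / 2); rewrite -/(M k) -[(M k).+1%:R]natr1.
have : expR (- (T * psum v k.+1)) * expR (T * psum v k.+1) = 1.
  by rewrite -expRD addNr expR0.
by rewrite /hi /lo !expRD; nra.
Qed.

End Valuations.

(** * Limits along a filter *)

Section Limits.
Variables (R : realType) (F : set_system R) (FF : ProperFilter F).
Implicit Types (f : R -> \bar R).

Lemma limf_einf_ge f (l : \bar R) : (\forall T \near F, (l <= f T)%E) ->
  (l <= limf_einf f F)%E.
Proof.
move=> lf; rewrite limf_einfE.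
apply: (@le_trans _ _ (ereal_inf (f @` [set T | (l <= f T)%E]))).
  by apply: le_ereal_inf_tmp => _ [T lT <-].
by apply: ereal_sup_ubound; exists [set T | (l <= f T)%E].
Qed.

Lemma limf_esup_le f (l : \bar R) : (\forall T \near F, (f T <= l)%E) ->
  (limf_esup f F <= l)%E.
Proof.
move=> lf; rewrite limf_esupE.
apply: (@le_trans _ _ (ereal_sup (f @` [set T | (f T <= l)%E]))).
  by apply: ereal_inf_lbound; exists [set T | (f T <= l)%E].
by apply: ge_ereal_sup => _ [T lT <-].
Qed.

Lemma limf_einf_le_esup f : (limf_einf f F <= limf_esup f F)%E.
Proof.
rewrite limf_einfE limf_esupE; apply: ge_ereal_sup => _ [V FV <-].
apply: le_ereal_inf_tmp => _ [W FW <-].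
have [T [VT WT]] := filter_ex (filterI FV FW).
apply: (@le_trans _ _ (f T)).
  by apply: ereal_inf_lbound; exists T.
by apply: ereal_sup_ubound; exists T.
Qed.

End Limits.

(** * Estimates on the exponential *)

Section Estimates.
Variable R : realType.
Implicit Types (x a c eta : R).

Lemma near_expR_lt a c eta : 0 < c -> 0 < eta ->
  \forall T \near +oo, expR (a - T * c) < eta.
Proof.
move=> c0 eta0; near=> T.
rewrite -[eta]lnK ?posrE // ltr_expR ltrBlDr -ltrBlDl -ltr_pdivrMr //.
by near: T; apply: nbhs_pinfty_gt; exact: num_real.
Unshelve. all: by end_near. Qed.

Lemma expR_sub_expRN_le x : 0 <= x -> x <= 2^-1 ->
  expR x - expR (- x) <= 2 * x + 2 * x ^+ 2.
Proof.
move=> x0 x1; have e1 : 1 - x <= expR (- x) by have := expR_ge1Dx (- x).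
have e2 : expR x * expR (- x) = 1 by rewrite -expRD subrr expR0.
have e3 : 0 < expR x by exact: expR_gt0.
have : expR x * (1 - x) <= 1 by rewrite -[leRHS]e2 ler_pM2l.
have : 1 <= (1 + x + 2 * x ^+ 2) * (1 - x) by nra.
move=> h1 h2; have h3 : expR x <= 1 + x + 2 * x ^+ 2.
  by rewrite -(@ler_pM2r _ (1 - x)); lra.
lra.
Qed.

Lemma expR_sub_expRN_ge x : 0 <= x -> x <= 2^-1 ->
  5 / 3 * x <= expR x - expR (- x).
Proof.
move=> x0 x1; have e1 : 1 + x <= expR x by exact: expR_ge1Dx.
have e2 : expR x * expR (- x) = 1 by rewrite -expRD subrr expR0.
have e3 : 0 < expR (- x) by exact: expR_gt0.
have : (1 + x) * expR (- x) <= 1 by rewrite -[leRHS]e2 ler_pM2r.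
move=> h; have h1 : expR (- x) <= 1 - 2 / 3 * x.
  rewrite -(@ler_pM2l _ (1 + x)); last by lra.
  by apply: le_trans h _; nra.
lra.
Qed.

Lemma prod_natSS c (m : nat) :
  \prod_(k < m) (c * k.+2%:R) = c ^+ m * (m.+1)`!%:R.
Proof.
elim: m => [|m IH]; first by rewrite big_ord0 expr0 mul1r.
by rewrite big_ord_recr /= IH exprSr [in RHS]factS natrM mulrACA [X in _ * X]mulrC.
Qed.

End Estimates.

(** * Asymptotics of the counts *)

Lemma ltn_ord_predS n (k : 'I_n.-1) : (0 < k.+1 < n)%N.
Proof. by have := ltn_ord k; lia. Qed.

Section Asymptotics.
Variables (R : realType) (n : nat) (v : 'rV[R]_n) (d e : R).
Hypotheses (n_gt1 : (1 < n)%N) (hv : Hplus v) (d_gt0 : 0 < d) (vd : gap v d).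
Hypotheses (e_gt0 : 0 < e) (ed : 2 * e <= d) (e_small : n%:R ^+ 2 * e <= 2^-1).

Lemma growth_gt0 T : 0 < growth v T.
Proof. exact: expR_gt0. Qed.

(** The bound on n^2 eps makes the quadratic error (k eps)^2 in the expansion
    of e^(k eps) - e^(- k eps) small against eps. *)
Lemma scale_small k : (k <= n)%N ->
  [/\ 0 <= k%:R * e, k%:R * e <= 2^-1 & (k%:R * e) ^+ 2 <= 2^-1 * e].
Proof.
move=> kn; have k0 : 0 <= k%:R :> R by exact: ler0n.
have kR : k%:R <= n%:R :> R by rewrite ler_nat.
have n1 : 1 <= n%:R :> R by rewrite ler1n; lia.
have k2 : k%:R ^+ 2 * e <= 2^-1.
  by apply: le_trans e_small; rewrite ler_pM2r // ler_sqr ?nnegrE.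
have e0 := e_gt0; have es := e_small; split.
- by rewrite mulr_ge0 // ltW.
- by apply: le_trans es; rewrite ler_pM2r //; apply: le_trans kR _; nra.
- by rewrite exprMn expr2 [e ^+ 2]expr2 mulrA -expr2 ler_pM2r.
Qed.

Lemma coef_window_ge0 T k : 0 <= coef_window v d e T k.
Proof.
rewrite /coef_window; apply: addr_ge0; last by rewrite mulr_ge0 ?expR_ge0.
apply: addr_ge0; last by rewrite !mulr_ge0 ?exprn_ge0 ?expR_ge0.
by rewrite subr_ge0 ler_expR -subr_ge0 opprK addr_ge0 // mulr_ge0 // ltW.
Qed.

(** By [expR_sub_expRN_le] the difference of exponentials in the window of index
    k is at most 2 k eps + eps. Below the bound 2 (k + 1) eps this leaves room
    eps for the terms that decay with T. *)
Lemma near_coef_window_le : \forall T \near +oo,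
  forall k : 'I_n.-1, coef_window v d e T k.+1 <= 2 * e * k.+2%:R.
Proof.
apply: filter_forall => k.
have /andP[_ kn] := ltn_ord_predS k.
have [x0 x1 x2] := scale_small (ltnW kn).
have Vk := psum_gt0 hv (ltn_ord_predS k).
have e8 : 0 < e / 8 / 2 ^+ n by rewrite !divr_gt0 ?exprn_gt0.
have e8' : 0 < e / 8 by rewrite divr_gt0.
have w1 := expR_sub_expRN_le x0 x1.
near=> T.
rewrite /coef_window.
have t1 : expR (k.+1%:R * e - T * d) < e / 8 / 2 ^+ n.
  by near: T; exact: near_expR_lt.
have t2 : expR (0 - T * psum v k.+1) < e / 8.
  by near: T; exact: near_expR_lt.
have t1' : 2 ^+ n * expR (k.+1%:R * e - T * d) < e / 8.
  by rewrite mulrC -ltr_pdivlMr ?exprn_gt0.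
rewrite sub0r in t2.
rewrite -[k.+2%:R]natr1; lra.
Unshelve. all: by end_near. Qed.

Lemma near_unit_count_le : \forall T \near +oo,
  (unit_count v e T <= (2 * (4 * e) ^+ (n - 1) * n`!%:R * growth v T)%:E)%E.
Proof.
near=> T.
apply: le_trans (unit_count_le n_gt1 vd d_gt0 e_gt0 ed _) _.
  by near: T; apply: nbhs_pinfty_ge; exact: num_real.
rewrite lee_fin ler_pM2r ?growth_gt0 // -mulrA ler_pM2l //.
have -> : n`! = (n.-1.+1)`! by rewrite prednK // ltnW.
rewrite subn1 -prod_natSS; apply: ler_prod => k _.
rewrite mulr_ge0 ?coef_window_ge0 //=.
have : coef_window v d e T k.+1 <= 2 * e * k.+2%:R.
  by move: k; near: T; exact: near_coef_window_le.
lra.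
Unshelve. all: by end_near. Qed.

Lemma unit_count_le_growth : exists2 C : R, 0 < C &
  forall T, 1 <= T -> (unit_count v e T <= (C * growth v T)%:E)%E.
Proof.
pose W (k : nat) := expR (k%:R * e) + 2 * (2 ^+ n * expR (k%:R * e)) + 2.
exists (2 * \prod_(k < n.-1) (2 * W k.+1)).
  rewrite mulr_gt0 // prodr_gt0 // => k _.
  by rewrite mulr_gt0 // !addr_gt0 ?mulr_gt0 ?exprn_gt0 ?expR_gt0.
move=> T T1; apply: le_trans (unit_count_le n_gt1 vd d_gt0 e_gt0 ed T1) _.
rewrite lee_fin ler_pM2r ?growth_gt0 // ler_pM2l //.
apply: ler_prod => k _; rewrite mulr_ge0 ?coef_window_ge0 //= ler_pM2l //.
have T0 : 0 <= T by apply: le_trans T1.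
rewrite /W /coef_window !lerD //.
- by rewrite gerBl expR_ge0.
- rewrite !ler_pM2l ?exprn_gt0 // ler_expR gerBl mulr_ge0 // ltW //.
- rewrite -[leRHS]mulr1 ler_pM2l // -expR0 ler_expR oppr_le0 mulr_ge0 // ltW //.
  exact/psum_gt0/ltn_ord_predS.
Qed.

(** With delta = eps / 3 each factor of [unit_count_ge] tends to at least
    5 eps / 9, while the required factor is at most 4 eps / 9, since
    (n - 1) 3^n >= 9. Any e' strictly between 2 delta and eps would do. *)
Lemma near_unit_count_ge : \forall T \near +oo,
  ((2 * (4 * e / ((n - 1)%:R * 3 ^+ n)) ^+ (n - 1) * growth v T)%:E
     <= unit_count v e T)%E.
Proof.
have e0 := e_gt0.
pose delta := e / 3; pose e' := 5 / 6 * e.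
have delta0 : 0 < delta by rewrite divr_gt0.
have e1 : e <= 1.
  have [_ + _] := scale_small (ltnW n_gt1); rewrite mul1r; lra.
have delta1 : delta <= 2^-1 by rewrite /delta; lra.
have w1 := expR_sub_expRN_ge (ltW delta0) delta1.
pose E1 := expR (2 * delta - e').
have E11 : E1 < 1 by rewrite -expR0 ltr_expR /delta /e'; lra.
have cst : 4 * e / ((n - 1)%:R * 3 ^+ n) <= 4 / 9 * e.
  rewrite ler_pdivrMr; last first.
    by rewrite mulr_gt0 ?exprn_gt0 // ltr0n subn_gt0.
  have h1 : 1 <= (n - 1)%:R :> R by rewrite ler1n subn_gt0.
  have h2 : 9 <= 3 ^+ n :> R.
    rewrite (_ : 9 = 3 ^+ 2); last by ring.
    by rewrite ler_eXn2l // ltr1n.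
  have h3 : 9 <= (n - 1)%:R * 3 ^+ n :> R by nra.
  nra.
pose b := 2 * delta + n%:R * e'.
have nearV : \forall T \near +oo, forall k : 'I_n.-1,
    expR (0 - T * psum v k.+1) < e / 18.
  apply: filter_forall => k; apply: near_expR_lt; last by rewrite divr_gt0.
  exact/psum_gt0/ltn_ord_predS.
near=> T.
have T1 : 1 <= T by near: T; apply: nbhs_pinfty_ge; exact: num_real.
have wk (k : 'I_n.-1) : 2 * expR (- (T * psum v k.+1)) <= e / 9.
  have : expR (0 - T * psum v k.+1) < e / 18 by move: k; near: T.
  by rewrite sub0r; lra.
have large : E1 + n.+1%:R * expR (b - T * d) < 1.
  have : expR (b - T * d) < (1 - E1) / n.+1%:R.
    by near: T; apply: near_expR_lt => //; rewrite divr_gt0 // subr_gt0.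
  by rewrite ltr_pdivlMr // mulrC; lra.
have de1 : 2 * delta < e' by rewrite /delta /e'; lra.
have de2 : e' < e by rewrite /e'; lra.
apply: le_trans (unit_count_ge n_gt1 hv d_gt0 vd T1 delta0 de1 de2 ed large _).
  rewrite lee_fin ler_pM2r ?growth_gt0 // ler_pM2l //.
  rewrite -[X in _ ^+ X](_ : #|'I_n.-1| = (n - 1)%N); last by rewrite card_ord subn1.
  rewrite -prodr_const; apply: ler_prod => k _; apply/andP; split.
    by rewrite divr_ge0 ?mulr_ge0 ?exprn_ge0 ?ler0n // ltW.
  by apply: le_trans cst _; have := wk k; rewrite /delta in w1 *; lra.
by move=> k; have := wk k; rewrite /delta in w1 *; lra.
Unshelve. all: by end_near. Qed.

End Asymptotics.

Theorem theorem1p5 (R : realType) (n : nat) (hn : (2 <= n)%N)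
    (v : 'rV[R]_n) (hv : Hplus v) :
  \forall e \near 0^'+,
    asymp (unit_count v e) (growth v) /\
    let ratio : R -> \bar R :=
      fun T => (unit_count v e T * ((growth v T)^-1)%:E)%E in
    [/\ ((2 * (4 * e / ((n - 1)%:R * 3 ^+ n)) ^+ (n - 1))%:E
           <= limf_einf ratio +oo%R)%E,
        (limf_einf ratio +oo%R <= limf_esup ratio +oo%R)%E &
        (limf_esup ratio +oo%R <= (2 * (4 * e) ^+ (n - 1) * n`!%:R)%:E)%E].
Proof.
have [d d0 vd] := exists_gap hv.
have n2_gt0 : 0 < n%:R ^+ 2 :> R by rewrite exprn_gt0 // ltr0n ltnW.
near=> e.
have e0 : 0 < e by near: e; exact: nbhs_right_gt.
have ed : 2 * e <= d.
  have : e < d / 2 by near: e; apply: nbhs_right_lt; rewrite divr_gt0.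
  lra.
have es : n%:R ^+ 2 * e <= 2^-1.
  have : e < 2^-1 / n%:R ^+ 2 by near: e; apply: nbhs_right_lt; rewrite divr_gt0.
  by rewrite ltr_pdivlMr // mulrC => /ltW.
have upper := near_unit_count_le hn hv d0 vd e0 ed es.
have lower := near_unit_count_ge hn hv d0 vd e0 ed es.
have [C C0 Cle] := unit_count_le_growth hn hv d0 vd e0 ed.
have c0 : 0 < 2 * (4 * e / ((n - 1)%:R * 3 ^+ n)) ^+ (n - 1).
  by rewrite mulr_gt0 // exprn_gt0 // divr_gt0 ?mulr_gt0 ?exprn_gt0 // ltr0n subn_gt0.
have gV T : (0 <= (growth v T)^-1%:E)%E.
  by rewrite lee_fin invr_ge0 ltW // growth_gt0.
have gK T (c : R) : c%:E = ((c * growth v T)%:E * (growth v T)^-1%:E)%E.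
  by rewrite -EFinM mulfK // gt_eqF // growth_gt0.
split.
  by exists (2 * (4 * e / ((n - 1)%:R * 3 ^+ n)) ^+ (n - 1)), C.
split.
- apply: limf_einf_ge; apply: filterS lower; move=> T lT.
  by rewrite (gK T); exact: lee_wpmul2r.
- exact: limf_einf_le_esup.
- apply: limf_esup_le; apply: filterS upper => T lT.
  by rewrite [leRHS](gK T); exact: lee_wpmul2r.
Unshelve. all: by end_near. Qed.
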